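(* Let $X$ be a finite set with $|X|=v$, let $k\le v/2$, let $C$ be a set of vertices of the Johnson graph $J(v,k)$ (that is, of $k$-subsets of $X$), and suppose that there is a transitive imprimitive subgroup $G$ of $\mathrm{Sym}(X)$ which acts completely transitively on $C$, that is, whose orbits on the $k$-subsets of $X$ are exactly the cells of the distance partition of $J(v,k)$ with respect to $C$. Then there is a partition $\{Y_1,\ldots,Y_b\}$ of $X$ with $|Y_i|=a$ for all $i$, such that $C$ is one of the following sets, or the opposite of one of the following sets: (2) $b=2$, $k\le a$, and the set of all $k$-subsets of $X$ contained in $Y_1$ or in $Y_2$; (3) $a=2$, and the set of all $k$-subsets of $X$ containing at most one element from each $Y_i$; (4) $a,b\ge3$, $k=3$, and the set of all triples meeting each $Y_i$ in at most one point; (5) $k=2$, and the set of all pairs meeting each $Y_i$ in at most one point.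
   Context: The Johnson graph $J(v,k)$ has as vertices the $k$-subsets of a fixed $v$-set $X$, two being adjacent if they have exactly $k-1$ points in common. For a set $C$ of vertices, the distance partition with respect to $C$ is the partition $C_0=C,C_1,\ldots,C_r$ where $C_i$ consists of the vertices whose minimum distance to a vertex of $C$ is $i$, and $r$ (the covering radius) is the maximum such distance. The opposite of $C$ is $C_{\mathrm{opp}}:=C_r$. A transitive group on $X$ is imprimitive if it preserves a partition of $X$ into blocks of equal size $a$ with $1<a<v$.
   Formalization: The formal theorem assumes k ≥ 2. For k = 1 the statement is false: with v = 9, G = S_3 wr S_3 and C all singletons, every hypothesis holds but none of (2)–(5) is possible; for k ≤ 1, C is always the full vertex set. *)

(* Defs.v *)
From mathcomp Require Import all_boot all_fingroup all_solvable.
Set Implicit Arguments.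
Unset Strict Implicit.
Unset Printing Implicit Defensive.

(* The graph with vertex set V and adjacency relation e, both inside an       *)
(* ambient finite type T.                                                     *)
Section DistancePartition.

Variables (T : finType) (e : rel T).

Definition has_walk (n : nat) (x y : T) : bool :=
  [exists p : n.-tuple T, path e x p && (last x p == y)].

(* The least length of a walk from x to y; it is #|T|, larger than any actual *)
(* distance, when y cannot be reached from x.                                 *)
Definition gdist (x y : T) : nat :=
  find (fun n => has_walk n x y) (iota 0 #|T|).

(* The default value #|T| of the minimum is only relevant for C = set0.       *)
Definition set_dist (C : {set T}) (y : T) : nat :=
  \big[minn/#|T|]_(x in C) gdist x y.

Variables (V C : {set T}).

Definition covering_radius : nat := \max_(y in V) set_dist C y.

Definition dist_cell (i : nat) : {set T} := [set y in V | set_dist C y == i].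

(* For C = set0 and V nonempty the covering radius is #|T|, and this          *)
(* collection contains the empty set, so it is not the orbit set of any group *)
(* action.                                                                    *)
Definition distance_partition : {set {set T}} :=
  [set dist_cell i | i : 'I_covering_radius.+1].

Definition opposite : {set T} := dist_cell covering_radius.

End DistancePartition.

Section Johnson.

Variables (X : finType) (k : nat).

Definition ksubsets : {set {set X}} := [set A : {set X} | #|A| == k].

(* Written with a successor so that J(v,0) has no loop.                       *)
Definition johnson_adj : rel {set X} :=
  [rel A B : {set X} | [&& A \in ksubsets, B \in ksubsets & #|A :&: B|.+1 == k]].

Definition johnson_partition (C : {set {set X}}) : {set {set {set X}}} :=
  distance_partition johnson_adj ksubsets C.

Definition johnson_opp (C : {set {set X}}) : {set {set X}} :=
  opposite johnson_adj ksubsets C.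

Definition completely_transitive (G : {group {perm X}}) (C : {set {set X}}) :=
  orbit 'P^* G @: ksubsets = johnson_partition C.

End Johnson.

(* G is transitive, so the blocks of an invariant partition Q all have the    *)
(* same size a, and the library's 1 < #|Q| < #|X| amounts to 1 < a < #|X|.    *)
Definition transitive_imprimitive (X : finType) (G : {group {perm X}}) : bool :=
  [transitive G, on [set: X] | 'P]
  && [exists Q, imprimitivity_system G [set: X] 'P Q].

Section Families.

Variables (X : finType) (k : nat) (Q : {set {set X}}).

Definition uniform_partition (a : nat) : bool :=
  partition Q [set: X] && [forall Y in Q, #|Y| == a].

Definition within_block : {set {set X}} :=
  [set A in ksubsets X k | [exists Y in Q, A \subset Y]].

Definition partial_transversals : {set {set X}} :=
  [set A in ksubsets X k | [forall Y in Q, #|A :&: Y| <= 1]].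

End Families.

(* Main.v *)
(* The cells of the distance partition are G-orbits, so every vertex of a cell
   C_i has neighbours in both C_(i-1) and C_(i+1) when these exist, and reversing
   the order of the cells gives the distance partition of the opposite of C.

   Let D be the family of k-sets inside a block, or (for k >= 3) that of partial
   transversals. It is a union of orbits. For A in D, the neighbours of A outside
   D can be joined by steps within that set, so they all lie in one cell, and
   each neighbour of A inside D is adjacent to one of them; hence A cannot lie
   in an interior cell. As D is connected modulo G, it is C or its opposite. For
   k = 2 the two families are complementary and the same follows for both.

   If there are at least 3 blocks, of size at least 3, and k >= 4, choose a set S
   of k-1 points meeting three blocks in distinct numbers of points. Adding to S
   a point of each of these blocks gives three pairwise adjacent k-sets. Two of
   them are in the same orbit, but their sums of squared block intersections are
   distinct, a contradiction. *)
Require Import Defs.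
From mathcomp Require Import all_boot all_fingroup all_solvable.
From mathcomp Require Import zify.
Set Implicit Arguments.
Unset Strict Implicit.
Unset Printing Implicit Defensive.

(** * Walks and distances to a set in a finite graph *)

Section Distance.

Variables (T : finType) (e : rel T).

Lemma has_walkP n x y :
  reflect (exists p, [/\ size p = n, path e x p & last x p = y])
          (has_walk e n x y).
Proof.
apply: (iffP existsP) => [[p /andP[p_path /eqP p_last]]|[p [sz_p p_path p_last]]].
  by exists p; rewrite size_tuple.
have sz : size p == n by apply/eqP.
by exists (Tuple sz); rewrite /= p_path p_last eqxx.
Qed.

Lemma gdist_max x y : gdist e x y <= #|T|.
Proof. by rewrite -[leqRHS](size_iota 0) find_size. Qed.

Lemma gdist_le n x y : has_walk e n x y -> gdist e x y <= n.
Proof.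
move=> walk_n; case: (leqP #|T| n) => [|n_lt]; first exact/leq_trans/gdist_max.
rewrite leqNgt; apply/negP => /(before_find 0).
by rewrite nth_iota // add0n walk_n.
Qed.

Lemma gdist_walk x y : gdist e x y < #|T| -> has_walk e (gdist e x y) x y.
Proof.
move=> lt_xy; have := lt_xy; rewrite -[ltnRHS](size_iota 0) -has_find => h.
by have := nth_find 0 h; rewrite nth_iota.
Qed.

(** Removing repetitions from a walk leaves at most [#|T|] vertices, so its length stays below the
    default value of [gdist]. *)
Lemma gdist_connect x y : connect e x y -> gdist e x y < #|T|.
Proof.
case/connectP => p p_path ->; case/shortenP: p_path => q q_path q_uniq _.
apply: leq_ltn_trans (_ : size q < _); first by apply: gdist_le; apply/has_walkP; exists q.
have -> : (size q).+1 = #|x :: q| by rewrite (card_uniqP q_uniq).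
exact: max_card.
Qed.

Lemma set_dist_max (C : {set T}) y : set_dist e C y <= #|T|.
Proof.
rewrite /set_dist; elim/big_rec: _ => // x n _ le_n.
by rewrite geq_min le_n orbT.
Qed.

Lemma set_dist_le (C : {set T}) x y : x \in C -> set_dist e C y <= gdist e x y.
Proof.
move=> xC; rewrite /set_dist; have: x \in index_enum T by rewrite mem_index_enum.
elim: (index_enum T) => //= z s IH; rewrite inE big_cons.
case/predU1P => [<-|/IH le_x]; first by rewrite xC geq_minl.
by case: ifP => // _; rewrite geq_min le_x orbT.
Qed.

Lemma set_dist_le_walk (C : {set T}) n x y :
  x \in C -> has_walk e n x y -> set_dist e C y <= n.
Proof. by move=> xC /gdist_le; apply/leq_trans/set_dist_le. Qed.

(** A value below the default [#|T|] comes from a term of the minimum, and that term from an actual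
    walk. *)
Lemma set_dist_attained (C : {set T}) y :
  set_dist e C y < #|T| -> exists2 x, x \in C & has_walk e (set_dist e C y) x y.
Proof.
move=> lt_y.
suff [eq_y|[x xC eq_y]] : set_dist e C y = #|T| \/
    exists2 x, x \in C & set_dist e C y = gdist e x y.
- by rewrite eq_y ltnn in lt_y.
- by exists x; rewrite // eq_y gdist_walk // -eq_y.
rewrite /set_dist; elim/big_rec: _ => [|x n xC IH]; first by left.
by case: (leqP (gdist e x y) n) => _; [right; exists x|].
Qed.

Lemma set_dist_adj (C : {set T}) x y :
  e x y -> set_dist e C y <= (set_dist e C x).+1.
Proof.
move=> xy; case: (ltnP (set_dist e C x) #|T|) => [/set_dist_attained|le_x].
  case=> z zC /has_walkP[p [sz_p p_path p_last]].
  apply: (set_dist_le_walk zC); apply/has_walkP; exists (rcons p y).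
  by rewrite size_rcons sz_p rcons_path p_path p_last last_rcons.
exact/leqW/(leq_trans (set_dist_max _ _)).
Qed.

Lemma set_dist_eq0 (C : {set T}) y : (set_dist e C y == 0) = (y \in C).
Proof.
apply/eqP/idP => [eq0|yC].
  have /set_dist_attained[x xC] : set_dist e C y < #|T|.
    by rewrite eq0; apply/card_gt0P; exists y.
  by rewrite eq0 => /has_walkP[[|z p] []] //= _ _ <-.
apply/eqP; rewrite -leqn0; apply: (set_dist_le_walk yC).
by apply/has_walkP; exists [::].
Qed.

(** The vertex before [y] on a shortest walk from [C] serves. Connectivity to a member of [C] rules
    out the default value. *)
Lemma set_dist_pred (C : {set T}) x y n :
    x \in C -> connect e x y -> set_dist e C y = n.+1 ->
  exists2 z, e z y & set_dist e C z = n.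
Proof.
move=> xC xy dy.
have /set_dist_attained[z zC] : set_dist e C y < #|T|.
  exact: leq_ltn_trans (set_dist_le _ xC) (gdist_connect xy).
rewrite dy => /has_walkP[p]; case/lastP: p => [|p w] [] //.
rewrite size_rcons last_rcons rcons_path => -[sz_p] /andP[p_path wy] eq_w.
exists (last z p); first by rewrite -eq_w.
apply/eqP; rewrite eqn_leq; apply/andP; split; last first.
  by rewrite -ltnS -dy set_dist_adj -?eq_w.
by apply: (set_dist_le_walk zC); apply/has_walkP; exists p.
Qed.

(* The instance needed: [C] is the last cell of a distance partition and [h y]
   is the covering radius minus the distance to the first cell. *)
Lemma set_dist_unique (V C : {set T}) (h : T -> nat) y :
    (forall x z, e x z -> x \in V) -> C \subset V ->
    {in V, forall x, (h x == 0) = (x \in C)} ->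
    {in V, forall x, h x <= #|T|} ->
    (forall x z, e x z -> h z <= (h x).+1) ->
    {in V, forall x n, h x = n.+1 -> exists2 z, e z x & h z = n} ->
  y \in V -> set_dist e C y = h y.
Proof.
move=> eV CV h0 h_max h_adj h_pred yV; apply/eqP; rewrite eqn_leq.
apply/andP; split.
  suff [x xC walk] : exists2 x, x \in C & has_walk e (h y) x y.
    exact: set_dist_le_walk walk.
  move: {2}(h y) (erefl (h y)) => n; elim: n y yV => [|n IH] y yV hy.
    exists y; first by rewrite -h0 // hy.
    by rewrite hy; apply/has_walkP; exists [::].
  have [z zy hz] := h_pred y yV n hy.
  have [x xC] := IH z (eV _ _ zy) hz.
  rewrite hz => /has_walkP[p [sz_p p_path p_last]].
  exists x => //; rewrite hy; apply/has_walkP; exists (rcons p y).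
  by rewrite size_rcons sz_p rcons_path p_path p_last last_rcons.
case: (ltnP (set_dist e C y) #|T|) => [/set_dist_attained[x xC]|]; last first.
  exact/leq_trans/h_max.
case/has_walkP => p [<- p_path <-].
have hx : h x = 0 by apply/eqP; rewrite h0 // (subsetP CV).
(* Writing [0] as [h x] lets the start vary: the value of [h] at the end of a walk is at most the
   length plus the value at the start. *)
rewrite -[size p]addn0 -hx; elim: p x {hx xC} p_path => //= z p IH x /andP[xz].
move=> /IH /leq_trans-> //; rewrite addSnnS leq_add2l; exact: h_adj.
Qed.

Lemma set_dist_covering_radius (V C : {set T}) y :
  y \in V -> set_dist e C y <= covering_radius e V C.
Proof. by move=> yV; apply: (@leq_bigmax_cond _ (mem V)). Qed.

Lemma covering_radius_attained (V C : {set T}) :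
  V != set0 -> exists2 y, y \in V & set_dist e C y = covering_radius e V C.
Proof.
case/set0Pn => x xV; have V_gt0 : 0 < #|mem V| by apply/card_gt0P; exists x.
by have [y yV eq_y] := eq_bigmax_cond (set_dist e C) V_gt0; exists y.
Qed.

End Distance.

(** * A criterion for a set to be the first or the last level *)

Section EndCell.

Variables (T : finType) (V D : {set T}) (e : rel T) (d : T -> nat) (r : nat).
Hypotheses (eV : forall x y, e x y -> x \in V /\ y \in V) (e_sym : symmetric e).
Hypothesis d_le : {in V, forall x, d x <= r}.
Hypothesis d_adj : forall x y, e x y -> d y <= (d x).+1.
Hypothesis d_pred :
  {in V, forall x n, d x = n.+1 -> exists2 z, e x z & d z = n}.
Hypothesis d_succ :
  {in V, forall x, d x < r -> exists2 z, e x z & d z = (d x).+1}.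
Hypotheses (DV : D \subset V) (D_neq0 : D != set0).
Hypothesis D_sat : {in D & V, forall x y, d x = d y -> y \in D}.
Hypothesis out : {in D, forall x, exists2 z, e x z & z \notin D}.
Hypothesis out_eq : {in D, forall x y z,
  e x y -> e x z -> y \notin D -> z \notin D -> d y = d z}.
Hypothesis out_adj : {in D &, forall x y,
  e x y -> exists z, [/\ e x z, e y z & z \notin D]}.
(** Connectivity of [D] modulo a group, phrased without the group: if no step inside [D] leaves the
    level of [x], that level contains [D]. Its proof may thus also use level-preserving moves that
    are not steps. *)
Hypothesis D_conn : {in D, forall x,
  (forall y z, y \in D -> z \in D -> e y z -> d y = d x -> d z = d x) ->
  {in D, forall z, d z = d x}}.

Let inV x : x \in D -> x \in V. Proof. exact: subsetP. Qed.

Lemma out_neq x z : x \in D -> e x z -> z \notin D -> d z <> d x.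
Proof.
by move=> xD /eV[_ zV] zD eq_d; case/negP: zD; apply: (D_sat xD).
Qed.

(** If [y] were in [D], the common neighbour given by [out_adj] would complete a triangle with three
    different levels, although levels of adjacent vertices differ by at most one. *)
Lemma out_side x y : x \in D -> e x y -> d y <> d x ->
  exists z, [/\ e x z, z \notin D & d z = d y].
Proof.
move=> xD xy neq; have [yD|yD] := boolP (y \in D); last by exists y.
have [z [xz yz zD]] := out_adj xD yD xy.
exists z; split=> //; move: (out_neq xD xz zD) (out_neq yD yz zD).
have yx : e y x by rewrite e_sym.
have zx : e z x by rewrite e_sym.
have zy : e z y by rewrite e_sym.
move: (d_adj xy) (d_adj xz) (d_adj yz) (d_adj yx) (d_adj zx) (d_adj zy).
by move: neq; clear; lia.
Qed.

Lemma end_level x : x \in D -> d x = 0 \/ d x = r.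
Proof.
move=> xD; have xr := d_le (inV xD).
case dx: (d x) => [|n]; first by left.
have [lt_xr|] := ltnP (d x) r; last by right; lia.
have [y xy dy] := d_pred (inV xD) dx.
have [z xz dz] := d_succ (inV xD) lt_xr.
(* Both neighbours are traded for vertices outside [D] at the same levels, and [out_eq] makes these
   two levels equal. *)
have [y' [xy' yD dy']] := out_side xD xy ltac:(lia).
have [z' [xz' zD dz']] := out_side xD xz ltac:(lia).
by move: (out_eq xD xy' xz' yD zD) dy dy' dz dz' dx; clear; lia.
Qed.

Lemma one_level n : {in D, forall x, d x = n} -> D = [set x in V | d x == n].
Proof.
move=> D_n; apply/setP => x; rewrite inE; apply/idP/andP => [xD|[xV /eqP dx]].
  by rewrite inV // D_n.
by have [y yD] := set0Pn _ D_neq0; apply: (D_sat yD) => //; rewrite D_n.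
Qed.

(* A set of the form [D] in the middle of the distance partition would have
   neighbours on both sides; the hypotheses make all neighbours outside [D] of
   a given vertex lie on the same side. *)
Lemma end_cell : D = [set x in V | d x == 0] \/ D = [set x in V | d x == r].
Proof.
have [/forall_inP D_r|] := boolP [forall x in D, d x == r].
  by right; apply: one_level => x /D_r/eqP.
rewrite negb_forall_in => /exists_inP[x xD /eqP dx]; left; apply: one_level.
have dx0 : d x = 0 by case: (end_level xD).
rewrite -dx0; apply: D_conn => // y z yD zD yz dy.
case: (end_level zD) => [|dz]; first by rewrite dx0.
have [r0|r_neq0] := eqVneq r 0; first by rewrite dz dx0.
(* A step inside [D] from level [0] to level [r] forces [r = 1]. No level is then left for the
   neighbour [w] of [x] outside [D], which saturation keeps off both [0] and [1]. *)
have r1 : r = 1 by have := d_adj yz; rewrite dy dx0 dz; lia.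
have [w xw wD] := out xD.
have [_ wV] := eV xw; have := d_le wV.
have wz : d w <> d z.
  by move/esym=> /(D_sat zD wV); rewrite (negPf wD).
by move: (out_neq xD xw wD) wz r1 dz dx0; clear; lia.
Qed.

End EndCell.

(** * Exchanges of points and connectivity in the Johnson graph *)

Section JohnsonGraph.

Variables (X : finType) (k : nat).
Implicit Types (A B : {set X}) (x y : X) (g : {perm X}).

Lemma card_exchange A x y : x \in A -> y \notin A -> #|y |: (A :\ x)| = #|A|.
Proof.
move=> xA yA; rewrite cardsU1 !inE (negPf yA) andbF.
by rewrite (cardsD1 x A) xA.
Qed.

(** Both differences of two adjacent sets are singletons; their elements are the exchanged
    points. *)
Lemma johnson_adjP A B :
  reflect (#|A| = k /\ exists x y, [/\ x \in A, y \notin A & B = y |: (A :\ x)])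
          (johnson_adj k A B).
Proof.
apply: (iffP and3P) => [[]|[cA [x [y [xA yA ->]]]]].
  rewrite !inE => /eqP cA /eqP cB /eqP cAB; split=> //.
  have /cards1P[x Dx] : #|A :\: B| == 1 by rewrite cardsD; apply/eqP; lia.
  have /cards1P[y Dy] : #|B :\: A| == 1.
    by rewrite cardsD setIC; apply/eqP; lia.
  have /setDP[xA xB] : x \in A :\: B by rewrite Dx inE.
  have /setDP[yB yA] : y \in B :\: A by rewrite Dy inE.
  exists x, y; split=> //; apply/setP => z.
  have := congr1 (fun S : {set X} => z \in S) Dx.
  have := congr1 (fun S : {set X} => z \in S) Dy; rewrite !inE.
  by case: eqVneq => [->|_]; case: eqVneq; case: (z \in A); case: (z \in B).
rewrite !inE card_exchange // cA eqxx; split=> //.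
suff -> : A :&: (y |: A :\ x) = A :\ x by rewrite -cA (cardsD1 x A) xA.
apply/setP => z; rewrite !inE.
by case: (eqVneq z y) => [->|_]; rewrite ?(negPf yA) ?andbF //= andbCA andbb.
Qed.

Lemma adj_exchange A x y :
  #|A| = k -> x \in A -> y \notin A -> johnson_adj k A (y |: (A :\ x)).
Proof. by move=> cA xA yA; apply/johnson_adjP; split=> //; exists x, y. Qed.

Lemma adj_exchange_in A x y y' : #|A| = k -> x \in A -> y \notin A ->
  y' \notin A -> y != y' -> johnson_adj k (y |: (A :\ x)) (y' |: (A :\ x)).
Proof.
move=> cA xA yA y'A neq_y.
have -> : y' |: (A :\ x) = y' |: ((y |: (A :\ x)) :\ y).
  congr (_ |: _); apply/setP => z; rewrite !inE.
  by case: (eqVneq z y) => // ->; rewrite (negPf yA) andbF.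
apply: adj_exchange; rewrite ?card_exchange // !inE ?eqxx //.
by rewrite eq_sym (negPf neq_y) (negPf y'A) andbF.
Qed.

Lemma adj_exchange_out A x x' y : #|A| = k -> x \in A -> x' \in A ->
  y \notin A -> x != x' -> johnson_adj k (y |: (A :\ x)) (y |: (A :\ x')).
Proof.
move=> cA xA x'A yA neq_x.
have neq_y z : z \in A -> (y == z) = false.
  by move=> zA; apply: contraNF yA => /eqP->.
have -> : y |: (A :\ x') = x |: ((y |: (A :\ x)) :\ x').
  apply/setP => z; rewrite !inE.
  case: (eqVneq z y) => [->|_] /=; first by rewrite (neq_y x') // orbT.
  by case: (eqVneq z x) => [->|_] /=; rewrite ?neq_x ?xA.
apply: adj_exchange; rewrite ?card_exchange // !inE ?eqxx.
  by rewrite [x' == x]eq_sym neq_x x'A orbT.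
by rewrite eq_sym neq_y.
Qed.

Lemma johnson_adj_sym : symmetric (@johnson_adj X k).
Proof. by move=> A B; rewrite /johnson_adj /= andbCA setIC. Qed.

Lemma johnson_adj_ksubsets A B :
  johnson_adj k A B -> A \in ksubsets X k /\ B \in ksubsets X k.
Proof. by case/and3P. Qed.

Lemma exchange_pair A B : #|A| = #|B| -> A != B ->
  exists x y, [/\ x \in A, x \notin B, y \in B & y \notin A].
Proof.
move=> cAB neq; have : ~~ (A \subset B).
  by apply: contra neq => sAB; rewrite eqEcard sAB cAB leqnn.
have : ~~ (B \subset A).
  by apply: contra neq => sBA; rewrite eq_sym eqEcard sBA cAB leqnn.
by case/subsetPn => y yB yA /subsetPn[x xA xB]; exists x, y.
Qed.

Lemma card_exchangeI A B x y : x \in A -> x \notin B -> y \in B -> y \notin A ->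
  #|A :&: B| < #|(y |: (A :\ x)) :&: B|.
Proof.
move=> xA xB yB yA.
have -> : (y |: A :\ x) :&: B = y |: (A :&: B).
  apply/setP => z; rewrite !inE; case: eqVneq => [->|_] //=.
  by case: eqVneq => [->|_] //=; rewrite (negPf xB) andbF.
by rewrite cardsU1 !inE (negPf yA).
Qed.

(** Exchanging a point outside [B] for a point of [B] enlarges the intersection with [B], whence the
    induction on [k - #|A :&: B|]. *)
Lemma johnson_connect A B : A \in ksubsets X k -> B \in ksubsets X k ->
  connect (johnson_adj k) A B.
Proof.
move: {2}(k - _) (leqnn (k - #|A :&: B|)) => n; elim: n A => [|n IH] A.
all: move=> le_n AV BV; have := AV; have := BV; rewrite !inE => /eqP cB /eqP cA.
all: have [->|neq] := eqVneq A B; first exact: connect0.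
all: have [|x [y [xA xB yB yA]]] := exchange_pair _ neq; first by rewrite cA cB.
all: have lt_I := card_exchangeI xA xB yB yA.
all: have le_I : #|(y |: (A :\ x)) :&: B| <= k by rewrite -cB subset_leq_card // subsetIr.
  lia.
apply: connect_trans (connect1 (adj_exchange cA xA yA)) _.
by apply: IH; rewrite ?inE ?card_exchange ?cA //; lia.
Qed.

Lemma johnson_adj_imset g A B :
  johnson_adj k [set g z | z in A] [set g z | z in B] = johnson_adj k A B.
Proof.
have injg := @perm_inj _ g.
by rewrite /johnson_adj /= !inE -imsetI ?card_imset // => ? ? ? ? /injg.
Qed.

End JohnsonGraph.

(** * Cells as orbits, and reversal of the distance partition *)

Section CompletelyTransitive.

Variables (X : finType) (k : nat) (G : {group {perm X}}) (C : {set {set X}}).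
Hypotheses (k_le : k <= #|X|) (CV : C \subset ksubsets X k).
Hypothesis GC : completely_transitive k G C.
Implicit Types (A B : {set X}) (g : {perm X}).

Local Notation V := (ksubsets X k).
Local Notation e := (johnson_adj k).
Local Notation d := (set_dist (johnson_adj k) C).
Local Notation r := (covering_radius (johnson_adj k) (ksubsets X k) C).

Lemma ksubsets_neq0 : V != set0.
Proof.
by rewrite -card_gt0 card_draws bin_gt0.
Qed.

Lemma orbit_setactP A B :
  reflect (exists2 g, g \in G & B = [set g z | z in A]) (B \in orbit 'P^* G A).
Proof. by apply: (iffP imsetP). Qed.

Lemma mem_dist_cell A i :
  (A \in dist_cell e V C i) = (A \in V) && (d A == i).
Proof. exact: in_set. Qed.

(** For empty [C] all distances take the positive default value, so the cell of index [0] is empty,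
    whereas orbits are not. *)
Lemma ct_neq0 : C != set0.
Proof.
apply/eqP => C0.
have d_max A : d A = #|{set X}| by rewrite /set_dist C0 big_set0.
have r_gt0 : 0 < r.
  have [A _ <-] := covering_radius_attained e C ksubsets_neq0.
  by rewrite d_max; apply/card_gt0P; exists set0.
have : dist_cell e V C 0 \in johnson_partition k C.
  by apply/imsetP; exists (Ordinal (isT : 0 < r.+1)).
rewrite -GC => /imsetP[A AV] /setP/(_ A); rewrite orbit_refl mem_dist_cell d_max.
have : 0 < #|{set X}| by apply/card_gt0P; exists set0.
by rewrite lt0n => /negPf->; rewrite andbF.
Qed.

Lemma level_orbit A B : A \in V -> B \in V -> d A = d B ->
  exists2 g, g \in G & B = [set g z | z in A].
Proof.
move=> AV BV dAB; apply/orbit_setactP.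
have le_r : d A < r.+1 by apply: set_dist_covering_radius.
have : dist_cell e V C (d A) \in johnson_partition k C.
  by apply/imsetP; exists (Ordinal le_r).
rewrite -GC => /imsetP[Z _] /setP DZ.
have := DZ A; have := DZ B; rewrite !mem_dist_cell dAB eqxx AV BV => ZB ZA.
by apply: (orbit_trans (esym ZB)); rewrite orbit_sym -ZA.
Qed.

Lemma level_act A g : A \in V -> g \in G -> d [set g z | z in A] = d A.
Proof.
move=> AV gG; have : orbit 'P^* G A \in johnson_partition k C.
  by rewrite -GC imset_f.
case/imsetP => i _ /setP Di.
have := Di [set g z | z in A]; have := Di A; rewrite orbit_refl.
have -> : [set g z | z in A] \in orbit 'P^* G A by apply/orbit_setactP; exists g.
by rewrite !mem_dist_cell => /esym/andP[_ /eqP->] /esym/andP[_ /eqP->].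
Qed.

Lemma level_adj A B : e A B -> d B <= (d A).+1.
Proof. exact: set_dist_adj. Qed.

Lemma level_le : {in V, forall A, d A <= r}.
Proof. by move=> A; apply: set_dist_covering_radius. Qed.

Lemma level_pred : {in V, forall A n, d A = n.+1 -> exists2 B, e A B & d B = n}.
Proof.
move=> A AV n dA; have [B BC] := set0Pn _ ct_neq0.
have [Z ZA dZ] := set_dist_pred BC (johnson_connect (subsetP CV _ BC) AV) dA.
by exists Z => //; rewrite johnson_adj_sym.
Qed.

Lemma level_attained n : n <= r -> exists2 A, A \in V & d A = n.
Proof.
have [Z ZV <-] := covering_radius_attained e C ksubsets_neq0.
move=> /subnKC; move: (d Z - n) => m; elim: m Z ZV => [|m IH] Z ZV dZ.
  by exists Z; rewrite // -dZ addn0.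
have [B ZB dB] : exists2 B, e Z B & d B = n + m.
  by apply: level_pred; rewrite // -dZ addnS.
by have [_ BV] := johnson_adj_ksubsets ZB; apply: IH BV _.
Qed.

(** Some vertex [Z] of the next level has a neighbour [B] at the level of [A]. A group element
    carrying [B] to [A] carries [Z] to the required neighbour. *)
Lemma level_succ : {in V, forall A, d A < r -> exists2 B, e A B & d B = (d A).+1}.
Proof.
move=> A AV lt_r; have [Z ZV dZ] := level_attained lt_r.
have [B ZB dB] := level_pred ZV dZ.
have [_ BV] := johnson_adj_ksubsets ZB.
have [g gG ->] := level_orbit BV AV dB.
exists [set g z | z in Z]; last by rewrite !level_act // dZ dB.
by rewrite johnson_adj_imset johnson_adj_sym.
Qed.

Lemma level0 : [set A in V | d A == 0] = C.
Proof.
apply/setP => A; rewrite inE set_dist_eq0.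
by apply/andb_idl/(subsetP CV).
Qed.

Lemma level_opp : [set A in V | d A == r] = johnson_opp k C.
Proof. by []. Qed.

(** The distance to the opposite is [r - d A]: by [level_succ] every vertex has a path climbing to
    the last cell. The covering radius is again [r], reached exactly on [C]. *)
Lemma johnson_oppK : johnson_opp k (johnson_opp k C) = C.
Proof.
set C' := johnson_opp k C.
have C'V : C' \subset V by apply/subsetP => A; rewrite inE => /andP[].
have d'E : {in V, forall A, set_dist e C' A = r - d A}.
  move=> A; apply: (@set_dist_unique _ _ V C' (fun A => r - d A)) => //=.
  - by move=> B Z /johnson_adj_ksubsets[].
  - by move=> B BV; rewrite inE BV subn_eq0 eqn_leq level_le.
  - move=> B BV; apply: leq_trans (leq_subr _ _) _.
    by apply/bigmax_leqP => Z _; apply: set_dist_max.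
  - move=> B Z; rewrite johnson_adj_sym => /level_adj; lia.
  move=> B BV n dB; have [|Z BZ dZ] := level_succ BV; first by lia.
  by exists Z; [rewrite johnson_adj_sym | lia].
have r'E : covering_radius e V C' = r.
  apply/eqP; rewrite eqn_leq; apply/andP; split.
    by apply/bigmax_leqP => A AV; rewrite d'E ?leq_subr.
  have [B BC] := set0Pn _ ct_neq0; have BV := subsetP CV _ BC.
  apply: leq_trans (set_dist_covering_radius e C' BV).
  by rewrite d'E // -[r in r <= _]subn0 leq_sub2l // leqn0 set_dist_eq0.
rewrite -[RHS]level0; apply/setP => A; rewrite !inE r'E.
apply: andb_id2l => AV; have : A \in V by rewrite inE.
move=> {}AV; rewrite d'E //; have := level_le AV; lia.
Qed.

End CompletelyTransitive.

(** * Families of [k]-sets defined by an invariant partition *)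

Section Blocks.

Variables (X : finType) (k : nat) (G : {group {perm X}}) (C Q : {set {set X}}).
Hypotheses (k_le : k <= #|X|) (CV : C \subset ksubsets X k).
Hypothesis GC : completely_transitive k G C.
Hypotheses (QX : partition Q [set: X]) (GQ : [acts G, on Q | 'P^*]).
Implicit Types (A B D : {set X}) (x y z : X) (g : {perm X}).

Local Notation V := (ksubsets X k).
Local Notation e := (johnson_adj k).
Local Notation d := (set_dist (johnson_adj k) C).
Local Notation bl := (pblock Q).

Lemma pblock_in x : bl x \in Q.
Proof. by apply: pblock_mem; rewrite (cover_partition QX) inE. Qed.

Lemma in_pblock x : x \in bl x.
Proof. by rewrite mem_pblock (cover_partition QX) inE. Qed.

Lemma pblock_def Y x : Y \in Q -> x \in Y -> bl x = Y.
Proof. by case/and3P: QX => _ tiQ _; apply: def_pblock. Qed.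

Lemma pblock_act g x : g \in G -> bl (g x) = [set g z | z in bl x].
Proof.
move=> gG; apply: pblock_def; last exact/imset_f/in_pblock.
by have := acts_act GQ gG (bl x); rewrite pblock_in.
Qed.

Lemma pblock_act_eq g x y : g \in G -> (bl (g x) == bl (g y)) = (bl x == bl y).
Proof.
by move=> gG; rewrite !pblock_act // (inj_eq (imset_inj (@perm_inj _ g))).
Qed.

(** Comparing blocks of pairs of points is the form that [pblock_act_eq] transports. A point of the
    nonempty set [A] names the block. *)
Lemma within_blockP A : 0 < k ->
  reflect (A \in V /\ {in A &, forall x y, bl x = bl y})
          (A \in within_block k Q).
Proof.
move=> k_gt0; rewrite !inE; apply: (iffP andP) => -[cA].
  case/exists_inP => Y YQ /subsetP AY; split=> // x y xA yA.
  by rewrite !(@pblock_def Y) ?AY.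
move=> A1; split=> //; have /card_gt0P[x xA] : 0 < #|A| by rewrite (eqP cA).
apply/exists_inP; exists (bl x); first exact: pblock_in.
by apply/subsetP => y yA; rewrite (A1 x y) ?in_pblock.
Qed.

Lemma partial_transversalsP A :
  reflect (A \in V /\ {in A &, injective bl}) (A \in partial_transversals k Q).
Proof.
rewrite !inE; apply: (iffP andP) => -[cA].
  move=> /forall_inP A1; split=> // x y xA yA eq_bl.
  apply: (card_le1_eqP (A1 _ (pblock_in x))); rewrite inE ?xA ?yA.
    by rewrite eq_bl in_pblock.
  exact: in_pblock.
move=> A1; split=> //; apply/forall_inP => Y YQ; apply/card_le1_eqP => x y.
by case/setIP => xA xY /setIP[yA yY]; apply: A1; rewrite // !(@pblock_def Y).
Qed.

(** * Steps leaving a union of cells *)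

Section Saturated.

Variable D : {set {set X}}.
Hypothesis D_sat : {in D & V, forall A B, d A = d B -> B \in D}.
Hypothesis DV : D \subset V.

(** Saturation puts [P] and [P'] one level away from [A]. On opposite sides they would be two levels
    apart, yet they are adjacent. *)
Lemma out_step A P P' : A \in D -> e A P -> e A P' -> P \notin D ->
  P' \notin D -> e P P' -> d P = d P'.
Proof.
move=> AD AP AP' PD P'D PP'.
have [_ PV] := johnson_adj_ksubsets AP.
have [_ P'V] := johnson_adj_ksubsets AP'.
have neq : d A <> d P by move/(D_sat AD PV); apply/negP.
have neq' : d A <> d P' by move/(D_sat AD P'V); apply/negP.
have PA : e P A by rewrite johnson_adj_sym.
have P'A : e P' A by rewrite johnson_adj_sym.
have P'P : e P' P by rewrite johnson_adj_sym.
move: neq neq' (level_adj C AP) (level_adj C AP') (level_adj C PA).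
move: (level_adj C P'A) (level_adj C PP') (level_adj C P'P).
by move: (d A) (d P) (d P') => ? ? ?; clear; lia.
Qed.

Lemma card_sat A : A \in D -> #|A| = k.
Proof. by move/(subsetP DV); rewrite inE => /eqP. Qed.

(** Together with [out_step_out], this compares outside neighbours of [A] by changing one exchanged
    point at a time. *)
Lemma out_step_in A x y y' : A \in D -> x \in A -> y \notin A -> y' \notin A ->
  y |: (A :\ x) \notin D -> y' |: (A :\ x) \notin D ->
  d (y |: (A :\ x)) = d (y' |: (A :\ x)).
Proof.
move=> AD xA yA y'A PD P'D; have [->//|neq] := eqVneq y y'.
have cA := card_sat AD.
by apply: (out_step AD) => //; rewrite ?adj_exchange ?adj_exchange_in.
Qed.

Lemma out_step_out A x x' y : A \in D -> x \in A -> x' \in A -> y \notin A ->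
  y |: (A :\ x) \notin D -> y |: (A :\ x') \notin D ->
  d (y |: (A :\ x)) = d (y |: (A :\ x')).
Proof.
move=> AD xA x'A yA PD P'D; have [->//|neq] := eqVneq x x'.
have cA := card_sat AD.
by apply: (out_step AD) => //; rewrite ?adj_exchange ?adj_exchange_out.
Qed.

(** A walk in [S] brings in points of [B] one by one until it reaches [B], without changing level.
    The subfamily [S] allows for a [D] that falls into several pieces, such as one for each
    block. *)
Lemma conn_exchange (S : {set {set X}}) A B :
    S \subset D ->
    (forall A, A \in S -> A != B -> exists x y,
      [/\ x \in A, x \notin B, y \in B, y \notin A & y |: (A :\ x) \in S]) ->
    A \in S -> #|B| = k ->
    (forall P P', P \in D -> P' \in D -> e P P' -> d P = d A -> d P' = d A) ->
  d B = d A.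
Proof.
move=> SD exS + cB D_A; move: {2 3}A (erefl (d A)) => A'.
move: {2}(k - #|A' :&: B|) (leqnn (k - #|A' :&: B|)) => n.
elim: n A' => [|n IH] A' le_n dA' AS; have cA := card_sat (subsetP SD _ AS).
all: have [<-//|neq] := eqVneq A' B.
all: have [x [y [xA xB yB yA PS]]] := exS _ AS neq.
all: have lt_I := card_exchangeI xA xB yB yA.
all: have le_I : #|(y |: (A' :\ x)) :&: B| <= k.
1,3: by rewrite -cB subset_leq_card // subsetIr.
  by move: le_n lt_I le_I; clear; lia.
apply: IH (PS); first by move: le_n lt_I; clear; lia.
apply/esym/(D_A A' _ (subsetP SD _ AS) (subsetP SD _ PS) _ (esym dA')).
exact: adj_exchange.
Qed.

Lemma end_family :
    D != set0 ->
    {in D, forall A, exists2 B, e A B & B \notin D} ->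
    {in D, forall A P P', e A P -> e A P' -> P \notin D -> P' \notin D ->
      d P = d P'} ->
    {in D &, forall A B, e A B -> exists P, [/\ e A P, e B P & P \notin D]} ->
    {in D, forall A,
      (forall P P', P \in D -> P' \in D -> e P P' -> d P = d A -> d P' = d A) ->
      {in D, forall B, d B = d A}} ->
  D = C \/ D = johnson_opp k C.
Proof.
move=> D0 out out_eq out_adj D_conn.
rewrite -{1}(level0 CV) -(level_opp k C).
apply: (@end_cell _ V D e d _ _ _ _ _ _ _ DV D0 D_sat) => //.
- by move=> A B; apply: johnson_adj_ksubsets.
- exact: johnson_adj_sym.
- exact: level_le.
- exact: level_adj.
- exact: level_pred GC.
- exact: level_succ GC.
Qed.

End Saturated.

(** Sets at equal levels lie in one orbit, and [G] permutes the blocks. *)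
Lemma within_block_sat : 0 < k ->
  {in within_block k Q & V, forall A B, d A = d B -> B \in within_block k Q}.
Proof.
move=> k_gt0 A B /(within_blockP _ k_gt0)[AV A1] BV.
case/(level_orbit GC AV BV) => g gG DB.
apply/within_blockP => //; split=> //; rewrite DB => x y.
case/imsetP => x' x'A -> /imsetP[y' y'A ->].
by apply/eqP; rewrite pblock_act_eq // (A1 x' y').
Qed.

Lemma partial_transversals_sat :
  {in partial_transversals k Q & V,
    forall A B, d A = d B -> B \in partial_transversals k Q}.
Proof.
move=> A B /partial_transversalsP[AV A1] BV.
case/(level_orbit GC AV BV) => g gG DB.
apply/partial_transversalsP => //; split=> //; rewrite DB => x y.
case/imsetP => x' x'A -> /imsetP[y' y'A ->] /eqP.
by rewrite pblock_act_eq // => /eqP/A1->.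
Qed.

Lemma within_block_end :
    1 < k -> [transitive G, on [set: X] | 'P] -> 1 < #|Q| ->
    within_block k Q != set0 ->
  within_block k Q = C \/ within_block k Q = johnson_opp k C.
Proof.
move=> k_gt1 trG Q_gt1 D0; have k_gt0 := ltnW k_gt1.
set D := within_block k Q in D0 *.
have DV : D \subset V by apply/subsetP => A; rewrite inE => /andP[].
have D_sat := within_block_sat k_gt0; rewrite -/D in D_sat.
have other x : exists y, bl y != bl x.
  have [Y YQ neqY] : exists2 Y, Y \in Q & Y != bl x.
    have : 0 < #|Q :\ bl x| by move: Q_gt1; rewrite (cardsD1 (bl x)) pblock_in.
    by case/card_gt0P => Y; rewrite !inE => /andP[neq YQ]; exists Y.
  have /set0Pn[y yY] : Y != set0 by case/and3P: QX => _ _; apply: contraNneq => <-.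
  by exists y; rewrite (pblock_def YQ yY).
have D_bl A x y : A \in D -> x \in A -> y \in A -> bl x = bl y.
  by move=> /(within_blockP _ k_gt0)[_ A1] xA yA; apply: A1.
have notinA A x y : A \in D -> x \in A -> bl y != bl x -> y \notin A.
  by move=> AD xA; apply: contraNN => yA; rewrite (D_bl A y x).
have exchD A x y : A \in D -> x \in A -> y \notin A ->
    (y |: (A :\ x) \in D) = (bl y == bl x).
  move=> AD xA yA; have cA := card_sat DV AD.
  apply/idP/eqP => [PD|eq_y].
    (* As [k > 1], a point [z] of [A] survives the removal of [x] and fixes the block of the new
       set. *)
    have /card_gt0P[z] : 0 < #|A :\ x| by move: k_gt1; rewrite -cA (cardsD1 x) xA.
    rewrite !inE => /andP[neq_z zA]; rewrite (D_bl A x z) //.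
    by apply: (D_bl _ y z PD); rewrite !inE ?eqxx // neq_z zA orbT.
  apply/within_blockP => //; split; first by rewrite inE card_exchange ?cA.
  suff A1 : {in y |: (A :\ x), forall z, bl z = bl x}.
    by move=> z w zP wP; rewrite !A1.
  by move=> z; rewrite !inE => /predU1P[->//|/andP[_ zA]]; apply: (D_bl A).
have [x0 A0] : exists x A, A \in D /\ x \in A.
  have [A AD] := set0Pn _ D0.
  have /card_gt0P[x xA] : 0 < #|A| by rewrite (card_sat DV AD).
  by exists x, A.
apply: end_family => //.
- move=> A AD; have cA := card_sat DV AD.
  have /card_gt0P[x xA] : 0 < #|A| by rewrite cA.
  have [y neq_y] := other x; have yA := notinA _ _ _ AD xA neq_y.
  by exists (y |: (A :\ x)); rewrite ?adj_exchange // exchD.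
- move=> A AD P P' /johnson_adjP[cA [x [y [xA yA ->]]]].
  case/johnson_adjP => _ [x' [y' [x'A y'A ->]]] PD P'D.
  (* The intermediate set removes [x] as [P] does and adds [y'] as [P'] does; it is outside [D]
     because [y'] is outside the block of [A]. *)
  have RD : y' |: (A :\ x) \notin D.
    by rewrite exchD // (D_bl A x x') // -(exchD A).
  by rewrite (out_step_in D_sat DV (y' := y')) // (out_step_out D_sat DV (x' := x')).
- move=> A B AD BD /johnson_adjP[cA [x [y [xA yA DB]]]].
  have [z neq_z] := other x; have zA := notinA _ _ _ AD xA neq_z.
  exists (z |: (A :\ x)); rewrite DB adj_exchange // exchD //; split=> //.
  apply: adj_exchange_in => //; apply: contraNneq neq_z => <-.
  by rewrite -(exchD A) // -DB.
move=> A AD DA B BD; have cA := card_sat DV AD; have cB := card_sat DV BD.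
have /card_gt0P[x xA] : 0 < #|A| by rewrite cA.
have /card_gt0P[y yB] : 0 < #|B| by rewrite cB.
(* Transitivity moves [B], within its level, into the block containing [A]. The exchanges towards
   the image then stay in that block. *)
have [g gG Dx] : exists2 g, g \in G & x = g y.
  by have := atransP2 trG (in_setT y) (in_setT x).
rewrite -(level_act GC (subsetP DV _ BD) gG).
set B' := [set g z | z in B].
have B'V : B' \in V by rewrite inE card_imset ?cB //; apply: perm_inj.
have B'D : B' \in D by apply: (D_sat _ _ BD B'V); rewrite (level_act GC) // (subsetP DV).
have xB' : x \in B' by rewrite Dx imset_f.
apply: (conn_exchange DV (S := [set P in D | [forall z in P, bl z == bl x]])) => //.
- by apply/subsetP => P; rewrite inE => /andP[].
- move=> P; rewrite inE => /andP[PD /forall_inP P_x] neq.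
  have [|u [w [uP uB wB wP]]] := exchange_pair _ neq.
    by rewrite !(card_sat DV).
  have bl_w : bl w = bl x by apply: (D_bl B').
  exists u, w; split=> //; rewrite inE exchD // bl_w (eqP (P_x u uP)) eqxx /=.
  apply/forall_inP => z; rewrite !inE => /predU1P[->|/andP[_ /P_x]//].
  exact/eqP.
- rewrite inE AD; apply/forall_inP => z zA; apply/eqP; exact: (D_bl A).
- exact: card_sat B'D.
Qed.

Lemma partial_transversals_end :
    2 < k -> {in Q, forall Y : {set X}, 1 < #|Y|} -> partial_transversals k Q != set0 ->
  partial_transversals k Q = C \/ partial_transversals k Q = johnson_opp k C.
Proof.
move=> k_gt2 Q_gt1 D0; have k_gt0 := ltnW (ltnW k_gt2).
set D := partial_transversals k Q in D0 *.
have DV : D \subset V by apply/subsetP => A; rewrite inE => /andP[].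
have D_sat := partial_transversals_sat; rewrite -/D in D_sat.
have other x : exists2 y, y != x & bl y = bl x.
  have : 0 < #|bl x :\ x|.
    by move: (Q_gt1 _ (pblock_in x)); rewrite (cardsD1 x) in_pblock.
  case/card_gt0P => y; rewrite !inE => /andP[neq yx]; exists y => //.
  exact: pblock_def (pblock_in x) yx.
have D_bl A x y : A \in D -> x \in A -> y \in A -> bl x = bl y -> x = y.
  by move=> /partial_transversalsP[_ A1] xA yA; apply: A1.
have notinA A x y : A \in D -> x \in A -> y != x -> bl y = bl x -> y \notin A.
  by move=> AD xA neq eq_bl; apply: contra neq => yA; rewrite (D_bl A y x).
have exchP A x y : A \in D -> x \in A -> y \notin A ->
    reflect (exists z, [/\ z \in A, z != x & bl y = bl z])
            (y |: (A :\ x) \notin D).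
  move=> AD xA yA; have cA := card_sat DV AD.
  apply: (iffP idP) => [PD|[z [zA neq eq_bl]]]; last first.
    apply: contra yA => PD; rewrite (D_bl _ y z PD) // !inE ?eqxx //.
    by rewrite neq zA orbT.
  have [/exists_inP[z zA /andP[neq /eqP eq_bl]]|] :=
    boolP [exists z in A, (z != x) && (bl y == bl z)]; first by exists z.
  rewrite negb_exists_in => /forall_inP no_z; case/negP: PD.
  have {}no_z z : z \in A -> z != x -> bl y <> bl z.
    by move=> zA neq /eqP eq_bl; have := no_z z zA; rewrite neq eq_bl.
  apply/partial_transversalsP; split; first by rewrite inE card_exchange ?cA.
  move=> z w; rewrite !inE => /predU1P[->|/andP[nz zA]] /predU1P[->|/andP[nw wA]] //.
  - by move/(no_z w wA nw).
  - by move/esym/(no_z z zA nz).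
  exact: (D_bl A).
(* This is where [k > 2] enters: two clashing points can be kept while a third is removed. *)
have third A z z' : A \in D -> exists2 x, x \in A & (z != x) && (z' != x).
  move=> AD; have /card_gt0P[x] : 0 < #|A :\: [set z; z']|.
    rewrite cardsD (card_sat DV AD); have := subset_leq_card (subsetIr A [set z; z']).
    by rewrite cards2; case: (z != z'); lia.
  by rewrite !inE negb_or ![x == _]eq_sym => /andP[? ?]; exists x.
apply: end_family => //.
- move=> A AD; have cA := card_sat DV AD.
  have /card_gt0P[z zA] : 0 < #|A| by rewrite cA.
  have [x xA /andP[neq _]] := third A z z AD.
  have [y neq_y eq_y] := other z; have yA := notinA _ _ _ AD zA neq_y eq_y.
  by exists (y |: (A :\ x)); [rewrite adj_exchange | apply/exchP => //; exists z].
- move=> A AD P P' /johnson_adjP[cA [x [y [xA yA ->]]]].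
  case/johnson_adjP => _ [x' [y' [x'A y'A ->]]] PD P'D.
  have [z [zA neq eq_bl]] := exchP _ _ _ AD xA yA PD.
  have [z' [z'A neq' eq_bl']] := exchP _ _ _ AD x'A y'A P'D.
  (* Here [y] clashes with [z] and [y'] with [z']. Removing [w] instead keeps both clashes, so the
     intermediate sets remain outside [D]. *)
  have [w wA /andP[zw z'w]] := third A z z' AD.
  have RD : y |: (A :\ w) \notin D by apply/exchP => //; exists z.
  have R'D : y' |: (A :\ w) \notin D by apply/exchP => //; exists z'.
  rewrite (out_step_out D_sat DV (x' := w)) // (out_step_in D_sat DV (y' := y')) //.
  exact: (out_step_out D_sat DV).
- move=> A B AD BD /johnson_adjP[cA [x [y [xA yA DB]]]].
  have [z zA /andP[neq _]] := third A x x AD; rewrite eq_sym in neq.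
  have [y' neq_y eq_y] := other z; have y'A := notinA _ _ _ AD zA neq_y eq_y.
  have PD : y' |: (A :\ x) \notin D by apply/exchP => //; exists z.
  exists (y' |: (A :\ x)); rewrite DB adj_exchange //; split=> //.
  by apply: adj_exchange_in => //; apply: contraNneq PD => <-; rewrite -DB.
move=> A AD DA B BD; apply: (conn_exchange DV (S := D)) => //; last exact: card_sat BD.
move=> P PD neq; have [|x [y [xP xB yB yP]]] := exchange_pair _ neq.
  by rewrite !(card_sat DV).
have [in_D|] := boolP (y |: (P :\ x) \in D); first by exists x, y.
(* The point [z] clashing with [y] is not in [B], which has [y] in that block already. Exchanging
   [z] instead leaves no clash: a second one would put two points of [P] in one block. *)
case/exchP => // z [zP neq_z eq_bl]; exists z, y; split=> //.
  by apply: contra yP => zB; rewrite (D_bl B y z).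
apply/negPn/negP => /(exchP _ _ _ PD zP yP)[w [wP neq_w eq_w]].
by case/eqP: neq_w; apply: (D_bl P); rewrite // -eq_w.
Qed.

End Blocks.

(** * Sizes of intersections with blocks *)

Lemma exists_subset_card (T : finType) (A B : {set T}) n :
  A \subset B -> #|A| <= n <= #|B| ->
  exists S : {set T}, [/\ A \subset S, S \subset B & #|S| = n].
Proof.
move=> AB /andP[le_An le_nB].
have : 0 < #|[set S : {set T} | S \subset B :\: A & #|S| == n - #|A|]|.
  by rewrite cards_draws bin_gt0 cardsD (setIidPr AB) leq_sub2r.
case/card_gt0P => S; rewrite inE => /andP[/subsetDP[SB SA] /eqP cS].
exists (A :|: S); rewrite subsetUl subUset AB SB; split=> //.
by rewrite cardsU setIC (disjoint_setI0 SA) cards0 subn0 cS subnKC.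
Qed.

Section BlockSizes.

Variables (X : finType) (Q : {set {set X}}).
Hypothesis QX : partition Q [set: X].
Implicit Types (S Y : {set X}) (x y : X).

Local Notation bl := (pblock Q).

(** A quantity constant on orbits of a group permuting the blocks. Squares make the effect of adding
    a point depend on how many points its block already contains. *)
Definition sq_sizes S := \sum_(Y in Q) #|S :&: Y| ^ 2.

Lemma sq_sizes_add S y : y \notin S ->
  sq_sizes (y |: S) = sq_sizes S + (2 * #|S :&: bl y|).+1.
Proof.
move=> yS; rewrite /sq_sizes (bigD1 (bl y)) ?(pblock_in QX) //=.
rewrite [in RHS](bigD1 (bl y)) ?(pblock_in QX) //=.
have -> : (y |: S) :&: bl y = y |: (S :&: bl y).
  by rewrite setIUl (setIidPl _) // sub1set (in_pblock QX).
rewrite cardsU1 inE (negPf yS) /=.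
rewrite (eq_bigr (fun Y => #|S :&: Y| ^ 2)) => [|Y /andP[YQ neqY]].
  by rewrite -!mulnn; lia.
congr (#|pred_of_set _| ^ 2); rewrite setIUl.
suff -> : [set y] :&: Y = set0 by rewrite set0U.
apply/setP => z; rewrite !inE; apply/negP => /andP[/eqP-> yY].
by rewrite (pblock_def QX YQ yY) eqxx in neqY.
Qed.

(** Applied with [n = k - 1]. The set [S] avoids [Y3], meets [Y2], and meets [Y1] in more points
    than [Y2], while omitting a point of each of the three. *)
Lemma exists_distinct_sizes a n : {in Q, forall Y, #|Y| = a} ->
    3 <= a -> 3 <= #|Q| -> 3 <= n -> 2 * n.+1 <= #|X| ->
  exists (S : {set X}) (y1 y2 y3 : X),
    [/\ #|S| = n, [/\ y1 \notin S, y2 \notin S & y3 \notin S]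
      & #|S :&: bl y3| < #|S :&: bl y2| < #|S :&: bl y1| ].
Proof.
move=> Q_a a_ge3 Q_ge3 n_ge3 n_le.
have X_ge : 3 * a <= #|X|.
  by rewrite -cardsT (card_uniform_partition Q_a QX) leq_mul2r Q_ge3 orbT.
have /card_gt2P[Y1 [Y2 [Y3 [[Y1Q Y2Q Y3Q] [neq12 neq23 neq31]]]]] := Q_ge3.
have /card_gt2P[y1 [p [p' [[y1Y pY p'Y] [neq_yp neq_pp neq_py]]]]] : 2 < #|Y1|.
  by rewrite Q_a.
have /card_gt2P[q [y2 [y2' [[qY y2Y y2'Y] [neq_qy neq_yy neq_yq]]]]] : 2 < #|Y2|.
  by rewrite Q_a.
have /card_gt0P[y3 y3Y] : 0 < #|Y3| by rewrite Q_a //; apply: leq_trans a_ge3.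
have notin Y Y' z : Y \in Q -> Y' \in Q -> Y != Y' -> z \in Y -> (z \in Y') = false.
  move=> YQ Y'Q neq zY; apply: contraNF neq => zY'.
  by rewrite -(pblock_def QX YQ zY) (pblock_def QX Y'Q zY').
have [in2 in3] : (forall z, z \in Y1 -> (z \in Y2) = false) /\
    (forall z, z \in Y1 -> (z \in Y3) = false).
  by split=> z; apply: notin => //; rewrite eq_sym.
have in3' z : z \in Y2 -> (z \in Y3) = false by exact: notin.
have neq_mem z z' Y : z \in Y -> (z' \in Y) = false -> (z == z') = false.
  by move=> zY z'Y; apply: contraFF z'Y => /eqP<-.
pose P1 := [set p; p'].
(* Every admissible [S] is sought inside [U]. The smaller set [M] keeps only [q] from [Y2]. *)
pose M := ~: ([set y1] :|: (Y2 :\ q) :|: Y3).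
pose U := ~: ([set y1] :|: [set y2; y2'] :|: Y3).
have LM : P1 :|: [set q] \subset M.
  apply/subsetP => z; rewrite !inE => /orP[/orP[]|] /eqP->.
  - by rewrite in2 // in3 // [p == y1]eq_sym (negPf neq_yp) andbF.
  - by rewrite in2 // in3 // (negPf neq_py) andbF.
  by rewrite in3' // eqxx (neq_mem _ _ _ qY (in2 _ y1Y)).
have MU : M \subset U.
  rewrite setCS; apply: setSU; apply: setUS; apply/subsetP => z.
  rewrite !inE => /orP[] /eqP->; first by rewrite y2Y eq_sym neq_qy.
  by rewrite y2'Y neq_yq.
have cL : #|P1 :|: [set q]| <= 3.
  by rewrite setUC cardsU1 cards2; case: (_ \notin _); case: (_ != _).
have cU : #|X| - (3 + a) <= #|U|.
  rewrite leq_subLR addnC -(cardsC U) setCK leq_add2l.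
  apply: leq_trans (leq_card_setU _ _).1 _; rewrite (Q_a Y3) // leq_add2r.
  apply: leq_trans (leq_card_setU _ _).1 _.
  by rewrite cards1 cards2; case: (_ != _).
have S_sizes S : S \subset U -> #|S| = n ->
    0 < #|S :&: Y2| -> #|S :&: Y2| < #|S :&: Y1| ->
  exists (S : {set X}) (y1 y2 y3 : X),
    [/\ #|S| = n, [/\ y1 \notin S, y2 \notin S & y3 \notin S]
      & #|S :&: bl y3| < #|S :&: bl y2| < #|S :&: bl y1| ].
  move=> /subsetP SU cS S2_gt0 S_lt; exists S, y1, y2, y3; split=> //.
    by split; apply/negP => /SU; rewrite !inE ?eqxx ?y3Y ?orbT.
  rewrite (pblock_def QX Y1Q y1Y) (pblock_def QX Y2Q y2Y) (pblock_def QX Y3Q y3Y) S_lt andbT.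
  suff -> : S :&: Y3 = set0 by rewrite cards0.
  apply/setP => z; rewrite !inE; apply/negP => /andP[/SU].
  by rewrite !inE => /norP[_ /negPf->].
(* If [n] points fit in [M], then [S] meets [Y2] in [q] alone and contains [p] and [p'] from [Y1].
   Otherwise [S] contains [M], hence [a - 1] points of [Y1], and at most [a - 2] of [Y2]. *)
case: (leqP n #|M|) => [le_nM|lt_Mn].
  have [|S [LS SM cS]] := exists_subset_card (n := n) LM.
    by rewrite le_nM (leq_trans cL).
  apply: (S_sizes S) => //; first exact: subset_trans MU.
    by apply/card_gt0P; exists q; rewrite inE qY (subsetP LS) // !inE eqxx orbT.
  have S2 : S :&: Y2 \subset [set q].
    apply/subsetP => z; rewrite !inE => /andP[/(subsetP SM)]; rewrite !inE.
    by move=> + zY; rewrite zY andbT => /norP[/norP[_ /negPn]].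
  have S1 : P1 \subset S :&: Y1.
    rewrite subsetI (subset_trans (subsetUl _ _) LS) /=.
    by apply/subsetP => z; rewrite !inE => /orP[] /eqP->.
  move: (subset_leq_card S1) (subset_leq_card S2).
  by rewrite cards1 cards2 neq_pp => /(leq_trans _) + le1; apply; rewrite ltnS.
have [|S [MS SU cS]] := exists_subset_card (n := n) MU.
  by rewrite (ltnW lt_Mn) (leq_trans _ cU) //; move: X_ge a_ge3 n_le; clear; lia.
apply: (S_sizes S) => //.
  apply/card_gt0P; exists q; rewrite inE qY (subsetP MS) //.
  by rewrite (subsetP LM) // !inE eqxx orbT.
have S2 : S :&: Y2 \subset Y2 :\: [set y2; y2'].
  apply/subsetP => z; rewrite !inE => /andP[/(subsetP SU)]; rewrite !inE.
  by move=> /norP[/norP[_ ->]].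
have S1 : Y1 :\ y1 \subset S :&: Y1.
  apply/subsetP => z; rewrite !inE => /andP[neq zY]; rewrite zY andbT.
  by apply: (subsetP MS); rewrite !inE (negPf neq) in2 // in3 // andbF.
move: (subset_leq_card S1) (subset_leq_card S2).
have y2Y' : [set y2; y2'] \subset Y2.
  by apply/subsetP => z; rewrite !inE => /orP[] /eqP->.
rewrite !cardsDS ?sub1set // cards1 cards2 neq_yy (Q_a Y1) // (Q_a Y2) //.
by move: a_ge3; clear; lia.
Qed.

End BlockSizes.

(** * The bound on [k], and the case of pairs *)

Section CompletelyTransitiveBlocks.

Variables (X : finType) (k : nat) (G : {group {perm X}}) (C Q : {set {set X}}).
Hypotheses (k_le : k <= #|X|) (CV : C \subset ksubsets X k).
Hypothesis GC : completely_transitive k G C.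
Hypotheses (QX : partition Q [set: X]) (GQ : [acts G, on Q | 'P^*]).
Implicit Types (A B D S : {set X}) (x y z : X) (g : {perm X}).

Local Notation V := (ksubsets X k).
Local Notation e := (johnson_adj k).
Local Notation d := (set_dist (johnson_adj k) C).
Local Notation r := (covering_radius (johnson_adj k) (ksubsets X k) C).
Local Notation bl := (pblock Q).

Lemma sq_sizes_act S g : g \in G -> sq_sizes Q [set g z | z in S] = sq_sizes Q S.
Proof.
move=> gG; rewrite /sq_sizes.
have injg : injective (fun Y : {set X} => [set g z | z in Y]).
  exact/imset_inj/perm_inj.
rewrite (reindex_inj injg) /=; apply: eq_big => [Y|Y _].
  exact: (acts_act GQ gG Y).
by rewrite -imsetI ?card_imset //; [apply: perm_inj | move=> ? ? ? ? /perm_inj].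
Qed.

Lemma sq_sizes_level : {in V &, forall A B, d A = d B -> sq_sizes Q A = sq_sizes Q B}.
Proof.
move=> A B AV BV /(level_orbit GC AV BV)[g gG ->].
by rewrite sq_sizes_act.
Qed.

(* Three pairwise adjacent vertices lie in at most two consecutive cells, so
   two of them are in the same orbit. *)
Lemma sq_sizes_triangle A B D : e A B -> e B D -> e A D ->
  [\/ sq_sizes Q A = sq_sizes Q B, sq_sizes Q B = sq_sizes Q D
    | sq_sizes Q A = sq_sizes Q D].
Proof.
move=> AB BD AD; have [AV BV] := johnson_adj_ksubsets AB.
have [_ DV] := johnson_adj_ksubsets BD.
have [BA DB DA] : [/\ e B A, e D B & e D A] by split; rewrite johnson_adj_sym.
have : [\/ d A = d B, d B = d D | d A = d D].
  move: (level_adj C AB) (level_adj C BD) (level_adj C AD).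
  move: (level_adj C BA) (level_adj C DB) (level_adj C DA).
  move: (d A) (d B) (d D) => i j l; clear => *.
  have [->|?] := eqVneq i j; first by constructor 1.
  have [->|?] := eqVneq j l; first by constructor 2.
  by constructor 3; lia.
by case=> eq_d; [constructor 1|constructor 2|constructor 3]; apply: sq_sizes_level.
Qed.

Lemma ct_card_le3 a : {in Q, forall Y : {set X}, #|Y| = a} -> 3 <= a -> 3 <= #|Q| ->
  2 * k <= #|X| -> k <= 3.
Proof.
move=> Q_a a_ge3 Q_ge3 k_le2; rewrite leqNgt; apply/negP => k_gt3.
have Dk : k.-1.+1 = k by rewrite prednK //; apply: leq_trans k_gt3.
have [||S [y1 [y2 [y3 [cS [y1S y2S y3S] /andP[lt32 lt21]]]]]] :=
  exists_distinct_sizes QX (n := k.-1) Q_a a_ge3 Q_ge3.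
- by rewrite -ltnS Dk.
- by rewrite Dk.
have adj y y' : y \notin S -> y' \notin S -> y != y' -> e (y |: S) (y' |: S).
  move=> yS y'S neq; have -> : y' |: S = y' |: ((y |: S) :\ y) by rewrite setU1K.
  apply: adj_exchange; rewrite ?cardsU1 ?yS ?cS ?Dk // !inE ?eqxx //.
  by rewrite negb_or eq_sym neq.
have neq y y' : #|S :&: bl y| < #|S :&: bl y'| -> y' != y.
  by apply: contraTneq => ->; rewrite ltnn.
have e12 := adj _ _ y1S y2S (neq _ _ lt21).
have e23 := adj _ _ y2S y3S (neq _ _ lt32).
have e13 := adj _ _ y1S y3S (neq _ _ (ltn_trans lt32 lt21)).
have := sq_sizes_triangle e12 e23 e13; rewrite !sq_sizes_add //.
(* Cancelling [sq_sizes Q S] leaves an equality of odd numbers [2m + 1] for two distinct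
   intersection sizes [m]. *)
by move: lt32 lt21; clear => ? ? [] /addnI; lia.
Qed.

Lemma within_block_neq0 Y : Y \in Q -> k <= #|Y| -> within_block k Q != set0.
Proof.
move=> YQ k_leY; have [|A [_ AY cA]] := exists_subset_card (n := k) (sub0set Y).
  by rewrite cards0.
apply/set0Pn; exists A; rewrite !inE cA eqxx; apply/exists_inP; by exists Y.
Qed.

(** Any [k] points of a full transversal will do. *)
Lemma partial_transversals_neq0 : k <= #|Q| -> partial_transversals k Q != set0.
Proof.
move=> k_leQ; have trT := transversalP QX.
have [|A [_ AT cA]] := exists_subset_card (n := k) (sub0set (transversal Q [set: X])).
  by rewrite cards0 (card_transversal trT).
apply/set0Pn; exists A; apply/(partial_transversalsP _ QX).
rewrite inE cA; split=> // x y xA yA.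
by apply: (pblock_inj trT); apply: (subsetP AT).
Qed.

(** For pairs the two families are complementary and every partial transversal is adjacent to a pair
    within a block. So [within_block_end] gives radius [1], and the partial transversals form the
    other end. *)
Lemma partial_transversals_end2 : k = 2 -> [transitive G, on [set: X] | 'P] -> 1 < #|Q| ->
    {in Q, forall Y : {set X}, 1 < #|Y|} ->
  partial_transversals k Q = C \/ partial_transversals k Q = johnson_opp k C.
Proof.
move=> k2 trG Q_gt1 Q_Y; have k_gt0 : 0 < k by rewrite k2.
have W_T A : A \in V -> (A \in partial_transversals k Q) = (A \notin within_block k Q).
  move=> AV; have /cards2P[x [y [neq DA]]] : #|A| == 2.
    by move: AV; rewrite inE k2.
  apply/(partial_transversalsP _ QX)/idP => [[_ A1]|AW].
    apply: contra neq => /(within_blockP QX _ k_gt0)[_ A1'].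
    by apply/eqP/A1/A1'; rewrite DA !inE eqxx ?orbT.
  split=> //; move: AW; rewrite DA => AW u v; rewrite !inE.
  have neq_bl : bl x <> bl y.
    move=> eq_bl; case/negP: AW; apply/(within_blockP QX _ k_gt0).
    by rewrite -DA; split=> // u' v'; rewrite DA !inE => /pred2P[] -> /pred2P[] ->.
  by move=> /pred2P[] -> /pred2P[] -> // /esym/neq_bl.
have TV A : A \in partial_transversals k Q -> A \in V.
  by rewrite inE => /andP[].
have adj_W A : A \in partial_transversals k Q ->
    exists2 B, B \in within_block k Q & e A B.
  move=> AT; have AV := TV _ AT; have := AV; rewrite inE => /eqP cA.
  have /cards2P[x [y [neq DA]]] : #|A| == 2 by rewrite cA k2.
  have [xA yA] : x \in A /\ y \in A by rewrite DA !inE !eqxx orbT.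
  have : 0 < #|bl x :\ x|.
    by move: (Q_Y _ (pblock_in QX x)); rewrite (cardsD1 x) (in_pblock QX).
  case/card_gt0P => z; rewrite !inE => /andP[neq_z zx].
  have eq_bl : bl z = bl x := pblock_def QX (pblock_in QX x) zx.
  have zA : z \notin A.
    apply: contra neq_z => zA.
    by have /(partial_transversalsP _ QX)[_ A1] := AT; apply/eqP/A1.
  exists (z |: (A :\ y)); last exact: adj_exchange.
  apply/(within_blockP QX _ k_gt0); split; first by rewrite inE card_exchange ?cA.
  suff Bx : {in z |: (A :\ y), forall u, bl u = bl x}.
    by move=> u v uB vB; rewrite !Bx.
  move=> u; rewrite !inE DA !inE => /predU1P[->//|/andP[nu]].
  by rewrite (negPf nu) orbF => /eqP->.
have [A0 A0T] : exists A, A \in partial_transversals k Q.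
  by apply/set0Pn/partial_transversals_neq0; rewrite k2.
have W0 : within_block k Q != set0.
  have [B BW _] := adj_W _ A0T; by apply/set0Pn; exists B.
case: (within_block_end k_le CV GC QX GQ _ trG Q_gt1 W0) => [|DW|DW].
- by rewrite k2.
- right; have d1 A : A \in partial_transversals k Q -> d A = 1.
    move=> AT; have [B BW AB] := adj_W _ AT.
    have : d B = 0 by apply/eqP; rewrite set_dist_eq0 -DW.
    have : d A != 0 by rewrite set_dist_eq0 -DW -W_T ?TV.
    have BA : e B A by rewrite johnson_adj_sym.
    by move: (level_adj C BA); case: (d A) => [|[|?]] // + _ dB; rewrite dB.
  have d01 A : A \in V -> d A <= 1.
    move=> AV; case AT: (A \in partial_transversals k Q); first by rewrite d1.
    by move/negbT: AT; rewrite W_T // negbK DW -(set_dist_eq0 e) => /eqP->.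
  have r1 : r = 1.
    apply/eqP; rewrite eqn_leq; apply/andP; split; first exact/bigmax_leqP.
    by rewrite -(d1 _ A0T); apply: level_le; apply: TV.
  apply/setP => A; rewrite -level_opp in_set r1.
  apply/idP/andP => [AT|[AV dA]]; first by rewrite TV ?d1.
  by rewrite W_T // DW -(set_dist_eq0 e) (eqP dA).
left; have W_r A : A \in V -> (A \in within_block k Q) = (d A == r).
  by move=> AV; rewrite DW -level_opp in_set AV.
have dT A : A \in partial_transversals k Q -> (d A).+1 = r.
  move=> AT; have [B BW AB] := adj_W _ AT; have AV := TV _ AT.
  have [_ BV] := johnson_adj_ksubsets AB.
  move: BW; rewrite W_r // => /eqP dB.
  have := AT; rewrite W_T // W_r // => neq.
  by move: (level_adj C AB) (level_le C AV) neq; rewrite dB; clear; lia.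
(* A member [B] of [C] has level [0]. Either it is a partial transversal, one level below [r], or it
   lies in the last cell; the latter gives [r = 0], against [dT]. *)
have r1 : r = 1.
  have [B BC] := set0Pn _ (ct_neq0 k_le GC); have BV := subsetP CV _ BC.
  have := BC; rewrite -(set_dist_eq0 e) => /eqP dB.
  case BT: (B \in partial_transversals k Q); first by rewrite -(dT B) ?dB.
  move/negbT: BT; rewrite W_T // W_r // dB negbK => /eqP r0.
  by have := dT _ A0T; rewrite -r0.
apply/setP => A; rewrite -[RHS](set_dist_eq0 e).
apply/idP/eqP => [/dT|dA]; first by rewrite r1 => -[].
have AV : A \in V by apply: (subsetP CV); rewrite -(set_dist_eq0 e) dA.
by rewrite W_T // W_r // dA r1.
Qed.

End CompletelyTransitiveBlocks.

(** * Case division on [k], the number of blocks and their size *)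

Theorem lemma3p2 (X : finType) (k : nat) (C : {set {set X}})
    (hk1 : 1 < k) (hk : 2 * k <= #|X|) (hC : C \subset ksubsets X k)
    (hG : exists G : {group {perm X}},
        transitive_imprimitive G /\ completely_transitive k G C) :
  exists (a : nat) (Q : {set {set X}}),
    uniform_partition Q a /\
    exists D : {set {set X}},
      [\/ [/\ #|Q| = 2, k <= a & D = within_block k Q],
          a = 2 /\ D = partial_transversals k Q,
          [/\ 3 <= a, 3 <= #|Q|, k = 3 & D = partial_transversals k Q]
        | k = 2 /\ D = partial_transversals k Q]
      /\ (C = D \/ C = johnson_opp k D).
Proof.
case: hG => G [/andP[trG /existsP[Q /and3P[QX GQ /andP[Q_gt1 Q_ltX]]]] GC].
have k_le : k <= #|X| by apply: leq_trans hk; rewrite leq_pmull.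
have [x0 _] : exists x0 : X, true.
  by have /card_gt0P[x _] : 0 < #|X| by [apply: leq_trans k_le; apply: ltnW]; exists x.
pose a := #|pblock Q x0|.
have Q_a : {in Q, forall Y : {set X}, #|Y| = a}.
  move=> Y YQ; have /set0Pn[y yY] : Y != set0.
    by case/and3P: QX => _ _; apply: contraNneq => <-.
  have [g gG Dx] : exists2 g, g \in G & x0 = g y.
    by have := atransP2 trG (in_setT y) (in_setT x0).
  rewrite /a Dx (pblock_act QX GQ) // card_imset; last exact: perm_inj.
  by rewrite (pblock_def QX YQ yY).
have cX : #|X| = #|Q| * a.
  by rewrite -cardsT (card_uniform_partition Q_a QX).
have a_gt1 : 1 < a.
  by move: Q_ltX; rewrite cardsT cX -[ltnLHS]muln1 ltn_pmul2l // ltnW.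
exists a, Q; split.
  by rewrite /uniform_partition QX; apply/forall_inP => Y /Q_a->.
(* The lemmas describe the family in terms of [C]; taking opposites twice turns this into a
   description of [C]. *)
have opp D : D = C \/ D = johnson_opp k C -> C = D \/ C = johnson_opp k D.
  by case=> ->; [left | right; rewrite (johnson_oppK k_le hC GC)].
have Q_Y : {in Q, forall Y : {set X}, 1 < #|Y|} by move=> Y /Q_a->.
have [k2|k_neq2] := eqVneq k 2.
  exists (partial_transversals k Q); split; first by constructor 4.
  exact/opp/(partial_transversals_end2 k_le hC GC QX GQ).
have k_gt2 : 2 < k by rewrite ltn_neqAle eq_sym k_neq2.
have [Q2|Q_neq2] := eqVneq #|Q| 2.
  (* With two blocks, [2 * k <= #|X|] reads [2 * k <= 2 * a]. *)
  have k_le_a : k <= a by move: hk; rewrite cX Q2 leq_pmul2l.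
  exists (within_block k Q); split; first by constructor 1.
  apply/opp/(within_block_end k_le hC GC QX GQ) => //.
  exact: within_block_neq0 (pblock_in QX x0) k_le_a.
have Q_gt2 : 2 < #|Q| by rewrite ltn_neqAle eq_sym Q_neq2.
exists (partial_transversals k Q).
(* The remaining cases share one family, and [k <= #|Q|] makes it nonempty. *)
suff [k_leQ cases] : k <= #|Q| /\ (a = 2 \/ 3 <= a /\ k = 3).
  split; first by case: cases => [a2|[a3 k3]]; [constructor 2|constructor 3].
  apply/opp/(partial_transversals_end k_le hC GC QX GQ) => //.
  exact: partial_transversals_neq0.
have [a2|a_neq2] := eqVneq a 2.
  by split; [move: hk; rewrite cX a2 mulnC leq_pmul2r | left].
have a_gt2 : 2 < a by rewrite ltn_neqAle eq_sym a_neq2.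
have k3 : k = 3.
  by apply/eqP; rewrite eqn_leq k_gt2 (ct_card_le3 GC QX GQ Q_a).
by rewrite k3; split; [|right].
Qed.
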